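(* Let $M$ be a $d\times d$ dilation matrix, $m=|\det M|$, and let $t\in\mathcal{Z}^0$. Then there exists a $d\times d$ trigonometric matrix $T$ such that $$\triangledown S_t(f)=S_T(\triangledown f)\qquad\forall f\in\ell_\infty .$$ Moreover, if $t(\mathbf{0})=m$ and such a $T$ satisfies $$\lim_{k\to+\infty}\|S_T^k\|_\infty=0,$$ then the scalar subdivision scheme $S_t$ is uniformly convergent.
   Context: A dilation matrix $M$ is a non-degenerate $d\times d$ integer matrix all of whose eigenvalues are larger than $1$ in modulus; $M^*$ is its transpose. A trigonometric polynomial is a function $t(x)=\sum_{n\in\mathbb{Z}^d}\widehat t(n)e^{2\pi i(n,x)}$ with finitely many non-zero coefficients. $D(M^* )$ is a set of representatives of the cosets $\mathbb{Z}^d/M^*\mathbb{Z}^d$ containing $\mathbf{0}$. $\mathcal{Z}^0$ is the set of trigonometric polynomials $t$ with $t({M^*}^{-1}s)=0$ for all $s\in D(M^* )$, $s\neq\mathbf{0}$. $\ell_\infty^N$ is the space of bounded sequences $f=\{f_\alpha\}_{\alpha\in\mathbb{Z}^d}$ with $f_\alpha\in\mathbb{R}^N$, normed by $\|f\|_\infty=\sup_\alpha|f_\alpha|$, where $|x|=\max_j|x_j|$; $\ell_\infty=\ell_\infty^1$. An $N\times N$ trigonometric matrix is $T(x)=\sum_{\alpha\in\mathbb{Z}^d}A_\alpha e^{-2\pi i(\alpha,x)}$, with $A_\alpha$ real $N\times N$ matrices, only finitely many non-zero (for $N=1$ this is a trigonometric polynomial $t$). The subdivision operator $S_T=S_{T,M}$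 on $\ell_\infty^N$ is $(S_Tf)_\alpha=\sum_{\beta\in\mathbb{Z}^d}A_{\alpha-M\beta}f_\beta$; $\|S_T^k\|_\infty$ is the operator norm on $\ell_\infty^N$. The sequence $\{S_T^k\}_{k\ge1}$ is the subdivision scheme $S_T$ (scalar if $N=1$). For $f\in\ell_\infty$, $\triangledown f\in\ell_\infty^d$ is $(\triangledown f)_\alpha=(f_\alpha-f_{\alpha-\mathbf{e}_1},\dots,f_\alpha-f_{\alpha-\mathbf{e}_d})^T$, with $\mathbf{e}_j$ the $j$-th unit vector. A scalar subdivision scheme $S_t$ is uniformly convergent if for every $f\in\ell_\infty$ there is a continuous function $S_t^\infty f:\mathbb{R}^d\to\mathbb{R}$ with $\lim_{k\to\infty}\sup_{\alpha\in\mathbb{Z}^d}|(S_t^kf)_\alpha-(S_t^\infty f)(M^{-k}\alpha)|=0$, and for at least one $f\in\ell_\infty$ the limit $S_t^\infty f$ is not identically zero. *)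

(* Defs.v *)
From HB Require Import structures.
From mathcomp Require Import all_boot all_order all_algebra.
From mathcomp Require Import complex.
From mathcomp Require Import all_classical all_reals all_analysis.

Set Implicit Arguments.
Unset Strict Implicit.
Unset Printing Implicit Defensive.

Import Order.TTheory GRing.Theory Num.Theory.
Import numFieldNormedType.Exports.

Local Open Scope classical_set_scope.
Local Open Scope ring_scope.
Local Open Scope complex_scope.

(* Points of Z^d and R^d are column vectors.  A trigonometric polynomial, or
   trigonometric matrix, T(x) = \sum_alpha A_alpha e^{-2 pi i (alpha, x)} is
   represented by its family of coefficients A. *)

Definition dilation_matrix (R : realType) (d : nat) (M : 'M[int]_d) : Prop :=
  \det M != 0 /\
  forall z : R[i], eigenvalue (map_mx intr M : 'M[R[i]]_d) z -> 1 < `|z|.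

Definition finitely_supported (d : nat) (V : nmodType)
    (A : 'cV[int]_d -> V) : Prop :=
  finite_set [set alpha | A alpha != 0].

Definition int_cV (R : realType) (d : nat) (alpha : 'cV[int]_d) : 'cV[R]_d :=
  map_mx intr alpha.

Definition inner (R : realType) (d : nat) (x y : 'cV[R]_d) : R :=
  \sum_j x j 0 * y j 0.

(* e^{-2 pi i theta} *)
Definition expNi2pi (R : realType) (theta : R) : R[i] :=
  cos (2 * pi * theta) -i* sin (2 * pi * theta).

(* In this and in the sums below, [\sum_(_ \in setT)] is the sum over the
   (finite) set of indices whose terms do not vanish. *)
Definition trig_eval (R : realType) (d : nat) (a : 'cV[int]_d -> R)
    (x : 'cV[R]_d) : R[i] :=
  \sum_(alpha \in [set: 'cV[int]_d])
    (a alpha)%:C * expNi2pi (inner (int_cV R alpha) x).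

Definition digit_set (d : nat) (B : 'M[int]_d) (D : set 'cV[int]_d) : Prop :=
  D 0 /\
  forall n : 'cV[int]_d,
    exists! s, D s /\ exists q : 'cV[int]_d, n = s + B *m q.

(* The class Z^0 of M; D is the digit set D(M^T). *)
Definition Z0 (R : realType) (d : nat) (M : 'M[int]_d) (D : set 'cV[int]_d)
    (a : 'cV[int]_d -> R) : Prop :=
  finitely_supported a /\
  forall s : 'cV[int]_d, D s -> s <> 0 ->
    trig_eval a (invmx (map_mx intr M^T) *m int_cV R s) = 0.

(* The sup-norm, valued in the extended reals so that it is +oo on unbounded
   sequences; on 'cV[R]_N the norm [`|_|] is the max-norm. *)
Definition linf_norm (R : realType) (d : nat) (V : normedZmodType R)
    (f : 'cV[int]_d -> V) : \bar R :=
  ereal_sup [set (`|f alpha|)%:E | alpha in [set: 'cV[int]_d]].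

Definition linf (R : realType) (d : nat) (V : normedZmodType R) :
    set ('cV[int]_d -> V) :=
  [set f | (linf_norm f < +oo)%E].
Arguments linf R d V : clear implicits.

Definition op_norm (R : realType) (d : nat) (V : normedZmodType R)
    (S : ('cV[int]_d -> V) -> ('cV[int]_d -> V)) : \bar R :=
  ereal_sup [set linf_norm (S f) | f in [set f | (linf_norm f <= 1)%E]].

Definition subdivision (R : realType) (d N : nat) (M : 'M[int]_d)
    (A : 'cV[int]_d -> 'M[R]_N) (f : 'cV[int]_d -> 'cV[R]_N) :
    'cV[int]_d -> 'cV[R]_N :=
  fun alpha => \sum_(beta \in [set: 'cV[int]_d])
    A (alpha - M *m beta) *m f beta.

(* The case N = 1, with 'M[R]_1 and 'cV[R]_1 replaced by R. *)
Definition scalar_subdivision (R : realType) (d : nat) (M : 'M[int]_d)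
    (a : 'cV[int]_d -> R) (f : 'cV[int]_d -> R) : 'cV[int]_d -> R :=
  fun alpha => \sum_(beta \in [set: 'cV[int]_d])
    a (alpha - M *m beta) * f beta.

Definition gradient (R : realType) (d : nat) (f : 'cV[int]_d -> R) :
    'cV[int]_d -> 'cV[R]_d :=
  fun alpha => \col_j (f alpha - f (alpha - delta_mx j 0)).

Definition subdivision_limit (R : realType) (d : nat) (M : 'M[int]_d)
    (a : 'cV[int]_d -> R) (f : 'cV[int]_d -> R) (g : 'cV[R]_d -> R) : Prop :=
  continuous g /\
  linf_norm (fun alpha : 'cV[int]_d =>
      iter k (scalar_subdivision M a) f alpha
      - g (invmx (map_mx intr M ^+ k) *m int_cV R alpha))
    @[k --> \oo] --> 0%E.

Definition uniformly_convergent (R : realType) (d : nat) (M : 'M[int]_d)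
    (a : 'cV[int]_d -> R) : Prop :=
  (forall f, linf R d R f -> exists g, subdivision_limit M a f g) /\
  (exists f g, [/\ linf R d R f, subdivision_limit M a f g
                 & exists x, g x != 0]).

(* Main.v *)
Require Import Defs.
From HB Require Import structures.
From mathcomp Require Import all_boot all_order all_algebra.
From mathcomp Require Import complex.
From mathcomp Require Import all_classical all_reals all_analysis.
From mathcomp Require Import ring lra zify.
Import Order.TTheory GRing.Theory Num.Theory.
Import numFieldNormedType.Exports.
Local Open Scope classical_set_scope.
Local Open Scope ring_scope.
Set Implicit Arguments.
Unset Strict Implicit.
Unset Printing Implicit Defensive.

(** Write m for |det M| and let e_j be the unit vectors of Z^d.

    The mask of the gradient scheme.  The zeros of t at the points M^-T s say
    that the sums of the coefficients of t over the cosets of M Z^d have no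
    nontrivial Fourier coefficient on the finite group Z^d / M Z^d; hence all
    these sums equal t(0) / m ([Z0_coset_sum]).  So t - t(. - e_j) has zero
    sum on every coset of M Z^d, and a finitely supported sequence with this
    property is a combination of differences T_i - T_i(. - M e_i)
    ([is_divergence_coset_sum0]).  These T_i form row j of the matrix mask:
    summation by parts moves the difference along M e_i in the mask to the
    difference along e_i in the data ([exists_gradient_mask]).

    Convergence.  If t(0) = m then the coset sums are all 1, so S_t reproduces
    constants: (S_t h)_alpha - h_beta is a combination of differences of h,
    bounded by a constant times the sup-norm of the gradient of h whenever
    alpha stays at bounded distance from M beta ([subdiv_local]).  Let u_k be
    the k-th iterate S_t^k f and consider the step functions
    h_k(x) = u_k (floor (M^k x)), for which h_k (M^-k alpha) = u_k alpha.  By the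
    previous remark |h_(k+1) - h_k| <= C |grad u_k|.  The gradients
    grad u_k = S_T^k (grad f) decay geometrically, because some power of S_T
    has norm at most 1/2; thus |grad u_k| <= P_k - P_(k+1) for a sequence P
    that tends to 0 ([geometric_tail]), and the h_k converge uniformly to a
    function g with |h_k - g| <= C P_k ([telescoping_limit]).  Taken at the
    points M^-k alpha this is the uniform convergence of the scheme.  The limit
    g is continuous although the h_k are not: for fixed k and y near x the
    points floor (M^k x) and floor (M^k y) differ by at most 1 in each
    coordinate, so the jump of h_k is at most d |grad u_k|, which is small when
    k is large.  The constant sequence 1 is its own limit, so not every limit
    vanishes. *)

(** * Finite sums over cosets of the lattice M Z^d *)

Lemma finsuppP (d : nat) (V : nmodType) (A : 'cV[int]_d -> V) :
  finitely_supported A <->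
  exists2 s : seq 'cV[int]_d, uniq s & forall x, x \notin s -> A x = 0.
Proof.
split=> [/finite_seqP[s As]|[s _ As]].
  exists (undup s) => [|x]; first exact: undup_uniq.
  rewrite mem_undup; apply: contraNeq => Ax.
  by have : [set` s] x by rewrite -As.
apply: (@sub_finite_set _ _ [set` s]); last exact: finite_seq.
by move=> x /=; apply: contraNT => /As ->.
Qed.

Lemma fsum_seq (I : choiceType) (V : nmodType) (F : I -> V) (s : seq I) :
  uniq s -> (forall i, i \notin s -> F i = 0) ->
  \sum_(i \in [set: I]) F i = \sum_(i <- s) F i.
Proof.
move=> us sF; rewrite [RHS]fsbig_seq//; apply/esym.
by apply: fsbig_widen => // i [_ /= /negP /sF].
Qed.

Section Cosets.
Variables (d : nat) (M : 'M[int]_d).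
Hypothesis detM : \det M != 0.

Lemma det_neq0_inj : injective (fun v : 'cV[int]_d => M *m v).
Proof.
move=> u v /(congr1 (mulmx (\adj M))); rewrite !mulmxA mul_adj_mx.
rewrite !mul_scalar_mx => /matrixP uv; apply/matrixP => i j.
by have := uv i j; rewrite !mxE => /(mulfI detM).
Qed.

(** The sums that define subdivision run over all beta with alpha - M beta in the
    support of the mask; M is injective, so this set is finite and the sums can
    be computed over a list. *)
Lemma coset_seq (s : seq 'cV[int]_d) (alpha : 'cV[int]_d) :
  exists2 r : seq 'cV[int]_d,
    uniq r & forall beta, (beta \in r) = (alpha - M *m beta \in s).
Proof.
have : finite_set [set beta | alpha - M *m beta \in s].
  apply: (@finite_preimage _ _ [set` s]); last exact: finite_seq.
  by move=> u v _ _ /(addrI alpha) /oppr_inj /det_neq0_inj.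
move=> /finite_seqP[r rE]; exists (undup r) => [|beta]; first exact: undup_uniq.
rewrite mem_undup; apply/idP/idP => rb.
  by have : [set` r] beta by []; rewrite -rE.
by have : [set` r] beta by rewrite -rE.
Qed.

Definition coset (gamma x : 'cV[int]_d) : bool :=
  `[< exists beta, x = gamma - M *m beta >].

Lemma coset_sum (V : nmodType) (a : 'cV[int]_d -> V) (s : seq 'cV[int]_d)
    (gamma : 'cV[int]_d) :
  uniq s -> (forall x, x \notin s -> a x = 0) ->
  \sum_(beta \in [set: 'cV[int]_d]) a (gamma - M *m beta) =
  \sum_(x <- s | coset gamma x) a x.
Proof.
move=> us sa; have [r ur rE] := coset_seq s gamma.
rewrite (@fsum_seq _ _ _ r)//; last by move=> b; rewrite rE => /sa.
rewrite -(@big_map _ _ _ _ _ (fun b => gamma - M *m b) r predT).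
rewrite -[RHS]big_filter; apply: perm_big; apply: uniq_perm.
- by rewrite map_inj_uniq// => u v /(addrI gamma) /oppr_inj /det_neq0_inj.
- exact: filter_uniq.
move=> x; rewrite mem_filter; apply/mapP/andP => [[b br ->]|[]].
  by rewrite -rE; split=> //; apply/asboolP; exists b.
by move=> /asboolP[b xE] xs; exists b => //; rewrite rE -xE.
Qed.

End Cosets.

(** * Existence of the mask of the gradient scheme *)

(** Z^d is generated as a group by the unit vectors. *)
Lemma int_vec_ind (d : nat) (P : 'cV[int]_d -> Prop) :
  P 0 -> (forall j, P (delta_mx j 0)) ->
  (forall u v, P u -> P v -> P (u + v)) -> (forall u, P u -> P (- u)) ->
  forall v, P v.
Proof.
move=> P0 Pe PD PN v; rewrite (matrix_sum_delta v).
apply: big_ind => // j _; rewrite big_ord1.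
have Pn n : P (n%:Z *: delta_mx j 0).
  elim: n => [|n IHn]; first by rewrite scale0r.
  by rewrite -(addn1 n) PoszD scalerDl scale1r; apply: PD.
by case: (v j 0) => n; rewrite ?NegzE ?scaleNr; [exact: Pn|exact/PN/Pn].
Qed.

Section Mask.
Variables (R : realType) (d : nat) (M : 'M[int]_d).
Hypothesis detM : \det M != 0.
Implicit Types (a b f : 'cV[int]_d -> R) (x v alpha gamma : 'cV[int]_d).

Lemma finsupp0 : finitely_supported (fun _ : 'cV[int]_d => 0 : R).
Proof. by apply/finsuppP; exists [::]. Qed.

Lemma finsuppD a b : finitely_supported a -> finitely_supported b ->
  finitely_supported (fun x => a x + b x).
Proof.
move=> /finsuppP[s _ sa] /finsuppP[r _ rb]; apply/finsuppP.
exists (undup (s ++ r)) => [|x]; first exact: undup_uniq.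
by rewrite mem_undup mem_cat negb_or => /andP[/sa -> /rb ->]; rewrite addr0.
Qed.

Lemma finsuppZ (c : R) a : finitely_supported a ->
  finitely_supported (fun x => c * a x).
Proof.
move=> /finsuppP[s us sa]; apply/finsuppP.
by exists s => // x /sa ->; rewrite mulr0.
Qed.

Lemma finsupp_shift v a : finitely_supported a ->
  finitely_supported (fun x => a (x - v)).
Proof.
move=> /finsuppP[s us sa]; apply/finsuppP.
exists [seq y + v | y <- s] => [|x]; first by rewrite map_inj_uniq//; exact: addIr.
move=> xs; apply: sa; apply: contra xs => xs; apply/mapP.
by exists (x - v) => //; rewrite subrK.
Qed.

Lemma finsuppB a b : finitely_supported a -> finitely_supported b ->
  finitely_supported (fun x => a x - b x).
Proof.
move=> fa fb; have := finsuppD fa (finsuppZ (-1) fb).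
by congr finitely_supported; apply/funext => x; rewrite mulN1r.
Qed.

Lemma finsupp_delta v : finitely_supported (fun x => (x == v)%:R : R).
Proof. by apply/finsuppP; exists [:: v] => // x; rewrite inE => /negPf ->. Qed.

Lemma subdivE a (s r : seq 'cV[int]_d) f alpha :
  (forall x, x \notin s -> a x = 0) -> uniq r ->
  (forall beta, alpha - M *m beta \in s -> beta \in r) ->
  scalar_subdivision M a f alpha = \sum_(beta <- r) a (alpha - M *m beta) * f beta.
Proof.
move=> sa ur rs; apply: fsum_seq => // beta.
by move=> /(contra (rs beta)) /sa ->; rewrite mul0r.
Qed.

Lemma subdivBl a b f alpha : finitely_supported a -> finitely_supported b ->
  scalar_subdivision M (fun x => a x - b x) f alpha =
  scalar_subdivision M a f alpha - scalar_subdivision M b f alpha.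
Proof.
move=> /finsuppP[s _ sa] /finsuppP[s' _ sb].
have [r ur rE] := coset_seq detM (s ++ s') alpha.
rewrite !(@subdivE _ (s ++ s') r)//.
- by rewrite -sumrB; apply: eq_bigr => beta _; rewrite mulrBl.
- by move=> x; rewrite mem_cat negb_or => /andP[_ /sb].
- by move=> beta; rewrite rE.
- by move=> x; rewrite mem_cat negb_or => /andP[/sa].
- by move=> beta; rewrite rE.
- by move=> x; rewrite mem_cat negb_or => /andP[/sa -> /sb ->]; rewrite subr0.
- by move=> beta; rewrite rE.
Qed.

Lemma subdivBr a f g alpha : finitely_supported a ->
  scalar_subdivision M a (fun x => f x - g x) alpha =
  scalar_subdivision M a f alpha - scalar_subdivision M a g alpha.
Proof.
move=> /finsuppP[s _ sa]; have [r ur rE] := coset_seq detM s alpha.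
rewrite !(@subdivE _ s r)// => [|beta|beta|beta]; rewrite ?rE//.
by rewrite -sumrB; apply: eq_bigr => beta _; rewrite mulrBr.
Qed.

Lemma subdiv_suml (I : Type) (l : seq I) (F : I -> 'cV[int]_d -> R) f alpha :
  (forall i, finitely_supported (F i)) ->
  scalar_subdivision M (fun x => \sum_(i <- l) F i x) f alpha =
  \sum_(i <- l) scalar_subdivision M (F i) f alpha.
Proof.
move=> fF; suff [_ ->] : finitely_supported (fun x => \sum_(i <- l) F i x) /\
  scalar_subdivision M (fun x => \sum_(i <- l) F i x) f alpha =
  \sum_(i <- l) scalar_subdivision M (F i) f alpha by [].
elim: l => [|i l [fl IHl]].
  split; first by under eq_fun do rewrite big_nil; exact: finsupp0.
  by rewrite big_nil; apply: fsbig1 => beta _; rewrite big_nil mul0r.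
split; first by under eq_fun do rewrite big_cons; exact: finsuppD.
rewrite big_cons -IHl; under eq_fun do rewrite big_cons.
have fNl := finsuppB finsupp0 fl.
have -> : (fun x => F i x + \sum_(j <- l) F j x) =
          (fun x => F i x - (0 - \sum_(j <- l) F j x)).
  by apply/funext => x; rewrite sub0r opprK.
rewrite subdivBl// subdivBl//; last exact: finsupp0.
suff -> : scalar_subdivision M (fun=> 0) f alpha = 0 by rewrite sub0r opprK.
by apply: fsbig1 => beta _; rewrite mul0r.
Qed.

(** Summation by parts: a translation of the mask by the lattice vector M v is a
    translation of the data by v. *)
Lemma subdiv_shift a v f alpha :
  scalar_subdivision M (fun x => a (x - M *m v)) f alpha =
  scalar_subdivision M a (fun x => f (x - v)) alpha.
Proof.
rewrite /scalar_subdivision [RHS](reindex_fsbigT (fun x => x + v))/=.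
  by apply: eq_fsbigr => beta _; rewrite mulmxDr opprD addrA addrK.
by exists (fun x => x - v) => x; rewrite ?addrK ?subrK.
Qed.

(** The divergence of T for the difference quotients along the generators M e_i
    of the lattice; its subdivision operator factors through the gradient. *)
Definition lattice_divergence (T : 'I_d -> 'cV[int]_d -> R) : 'cV[int]_d -> R :=
  fun x => \sum_i (T i x - T i (x - M *m delta_mx i 0)).

Definition is_divergence b : Prop :=
  exists2 T : 'I_d -> 'cV[int]_d -> R,
    forall i, finitely_supported (T i) & b = lattice_divergence T.

Lemma is_divergence0 : is_divergence (fun=> 0).
Proof.
exists (fun _ _ => 0) => [i|]; first exact: finsupp0.
by apply/funext => x; rewrite /lattice_divergence big1// => i _; rewrite subr0.
Qed.

Lemma is_divergenceD a b : is_divergence a -> is_divergence b ->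
  is_divergence (fun x => a x + b x).
Proof.
move=> [T fT ->] [U fU ->]; exists (fun i x => T i x + U i x) => [i|].
  exact: finsuppD.
apply/funext => x; rewrite /lattice_divergence -big_split; apply: eq_bigr => i _.
by rewrite /= addrACA opprD.
Qed.

Lemma is_divergenceZ (c : R) a : is_divergence a ->
  is_divergence (fun x => c * a x).
Proof.
move=> [T fT ->]; exists (fun i x => c * T i x) => [i|]; first exact: finsuppZ.
apply/funext => x; rewrite /lattice_divergence mulr_sumr; apply: eq_bigr => i _.
by rewrite mulrBr.
Qed.

(** The v for which this holds at every gamma form a subgroup of Z^d: paths from
    gamma to gamma + M v telescope.  The generator e_j is the case where T_j is
    the point mass at gamma and the other T_i vanish. *)
Lemma is_divergence_delta v gamma :
  is_divergence (fun x => (x == gamma)%:R - (x == gamma + M *m v)%:R).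
Proof.
move: v gamma; apply: int_vec_ind => [gamma|j gamma|u v Pu Pv gamma|u Pu gamma].
- have := is_divergence0; congr is_divergence; apply/funext => x.
  by rewrite mulmx0 addr0 subrr.
- exists (fun i x => (i == j)%:R * (x == gamma)%:R) => [i|].
    exact/finsuppZ/finsupp_delta.
  apply/funext => x; rewrite /lattice_divergence (bigD1 j)//= big1 => [|i /negPf ->].
    by rewrite eqxx !mul1r addr0 (can2_eq (subrK _) (addrK _)).
  by rewrite !mul0r subr0.
- have := is_divergenceD (Pu gamma) (Pv (gamma + M *m u)).
  by congr is_divergence; apply/funext => x; rewrite mulmxDr addrA addrA subrK.
- have := is_divergenceZ (-1) (Pu (gamma + M *m - u)).
  congr is_divergence; apply/funext => x; rewrite mulmxN subrK.
  by rewrite mulN1r opprB.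
Qed.

Lemma is_divergence_sum (I : Type) (l : seq I) (F : I -> 'cV[int]_d -> R) :
  (forall i, is_divergence (F i)) ->
  is_divergence (fun x => \sum_(i <- l) F i x).
Proof.
move=> WF; elim: l => [|i l IHl].
  by under eq_fun do rewrite big_nil; exact: is_divergence0.
by under eq_fun do rewrite big_cons; exact: is_divergenceD.
Qed.

Lemma coset_refl x : coset M x x.
Proof. by apply/asboolP; exists 0; rewrite mulmx0 subr0. Qed.

Lemma coset_eqr x y z : coset M x y -> coset M x z = coset M y z.
Proof.
move=> /asboolP[u ->]; apply/asboolP/asboolP => -[v ->].
  by exists (v - u); rewrite mulmxBr opprB addrA subrK.
by exists (u + v); rewrite mulmxDr opprD addrA.
Qed.

(** Move the mass of b at each point to a representative of its coset, at the
    cost of a divergence; the mass collected at a representative is the sum of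
    b over the coset, which vanishes. *)
Lemma is_divergence_coset_sum0 b : finitely_supported b ->
  (forall gamma, \sum_(beta \in [set: 'cV[int]_d]) b (gamma - M *m beta) = 0) ->
  is_divergence b.
Proof.
move=> /finsuppP[s us sb] b0.
pose rep x := xget 0 [set y | coset M x y].
have repP x : coset M x (rep x).
  exact: (@xgetI _ _ [set y | coset M x y] x (coset_refl x)).
have rep_eq x y : coset M x y -> rep x = rep y.
  by move=> xy; congr xget; apply/seteqP; split=> z /=; rewrite (coset_eqr _ xy).
have rep_sum0 z : \sum_(x <- s) b x * (z == rep x)%:R = 0.
  have [zE|zN] := eqVneq (rep z) z; last first.
    rewrite big1// => x _; have [zx|_] := eqVneq z (rep x); last by rewrite mulr0.
    by have := repP x; rewrite -zx => /rep_eq xz; rewrite -xz -zx eqxx in zN.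
  rewrite -[RHS](b0 z) (coset_sum detM z us sb) [RHS]big_mkcond.
  apply: eq_bigr => x _.
  have -> : coset M z x = (z == rep x).
    apply/idP/eqP => [/rep_eq <-//|->].
    by rewrite -(coset_eqr x (repP x)) coset_refl.
  by case: eqP; rewrite ?mulr1 ?mulr0.
have -> : b = fun z => \sum_(x <- s) b x * ((z == x)%:R - (z == rep x)%:R).
  apply/funext => z; under eq_bigr do rewrite mulrBr.
  rewrite sumrB rep_sum0 subr0.
  have [zs|zs] := boolP (z \in s); last first.
    rewrite (sb _ zs) big_seq big1// => x xs.
    by have [zx|_] := eqVneq z x; rewrite ?mulr0// zx xs in zs *.
  rewrite (bigD1_seq z)//= eqxx mulr1 big1 ?addr0// => x.
  by rewrite eq_sym => /negPf ->; rewrite mulr0.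
apply: is_divergence_sum => x; apply: is_divergenceZ.
have /asboolP[v ->] := repP x.
by rewrite -mulmxN; exact: is_divergence_delta.
Qed.

(** A constant coset sum makes the coset sums of a - a(. - e_j) vanish for
    every j. *)
Lemma exists_gradient_mask a (c : R) : finitely_supported a ->
  (forall gamma, \sum_(beta \in [set: 'cV[int]_d]) a (gamma - M *m beta) = c) ->
  exists T : 'cV[int]_d -> 'M[R]_d, finitely_supported T /\
    forall f, gradient (scalar_subdivision M a f) = subdivision M T (gradient f).
Proof.
move=> fa ac.
have div_a j : is_divergence (fun x => a x - a (x - delta_mx j 0)).
  apply: is_divergence_coset_sum0 => [|gamma].
    exact: finsuppB fa (finsupp_shift _ fa).
  have := subdivBl (fun=> 1) gamma fa (finsupp_shift (delta_mx j 0) fa).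
  rewrite /scalar_subdivision.
  under eq_fsbigr do rewrite mulr1.
  under [X in _ = X - _ -> _]eq_fsbigr do rewrite mulr1.
  under [X in _ = _ - X -> _]eq_fsbigr do rewrite mulr1 addrAC.
  by rewrite !ac subrr.
have /choice[U UP] : forall j, exists T : 'I_d -> 'cV[int]_d -> R,
    (forall i, finitely_supported (T i)) /\
    (fun x => a x - a (x - delta_mx j 0)) = lattice_divergence T.
  by move=> j; have [T fT TE] := div_a j; exists T.
have /choice[S SP] : forall ji, exists s : seq 'cV[int]_d,
    forall x, x \notin s -> U ji.1 ji.2 x = 0.
  by move=> [j i]; have [/(_ i)/finsuppP[s _ sU] _] := UP j; exists s.
(* one list that contains the supports of all the entries *)
pose s := undup (flatten [seq S ji | ji : 'I_d * 'I_d]).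
have sU j i x : x \notin s -> U j i x = 0.
  rewrite mem_undup => xs; apply: (SP (j, i)); apply: contra xs => xs.
  by apply/flattenP; exists (S (j, i)) => //; apply: map_f; rewrite mem_enum.
pose T x : 'M[R]_d := \matrix_(j, i) U j i x.
have sT x : x \notin s -> T x = 0.
  by move=> xs; apply/matrixP => j i; rewrite !mxE sU.
exists T; split; first by apply/finsuppP; exists s => //; exact: undup_uniq.
move=> f; apply/funext => alpha; apply/matrixP => j k.
rewrite ord1 {k} !mxE.
have -> : scalar_subdivision M a f (alpha - delta_mx j 0) =
          scalar_subdivision M (fun x => a (x - delta_mx j 0)) f alpha.
  by apply: eq_fsbigr => beta _; rewrite addrAC.
have [fU UE] := UP j.
rewrite -subdivBl//; last exact: finsupp_shift.
rewrite UE /lattice_divergence subdiv_suml => [|i]; last first.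
  exact: finsuppB (fU i) (finsupp_shift _ (fU i)).
have [r ur rE] := coset_seq detM s alpha.
have -> : subdivision M T (gradient f) alpha =
    \sum_(beta <- r) T (alpha - M *m beta) *m gradient f beta.
  by apply: fsum_seq => // beta; rewrite rE => /sT ->; rewrite mul0mx.
rewrite summxE; under [RHS]eq_bigr do rewrite mxE.
rewrite exchange_big; apply: eq_bigr => i _.
rewrite subdivBl//; last exact: finsupp_shift.
rewrite subdiv_shift -subdivBr// (@subdivE _ s r)// => [|x|beta].
- by apply: eq_bigr => beta _; rewrite !mxE.
- exact: sU.
- by rewrite rE.
Qed.

End Mask.

(** * The quotient Z^d / B Z^d and its characters *)

Lemma prod_foldr (I : finType) (F : I -> nat) :
  foldr muln 1%N [seq F i | i : I] = (\prod_i F i)%N.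
Proof. by rewrite foldrE big_map big_enum. Qed.

(** In the Smith normal form B = L Dl Q the unimodular factors only change the
    bases of Z^d, so the images under L of the integer points of the box
    prod_i [0, |l_i|) represent the cosets of B Z^d, where l_i is the i-th
    diagonal entry of Dl. *)
Lemma coset_transversal (d : nat) (B : 'M[int]_d) : \det B != 0 ->
  exists (X : finType) (sigma : X -> 'cV[int]_d),
  [/\ #|X| = `|\det B|%N,
      forall n, exists x q, n = sigma x + B *m q
    & forall x y q, sigma x = sigma y + B *m q -> x = y].
Proof.
move=> detB; have [L Lu [Q Qu [l _ BE]]] := int_Smith_normal_form B.
set Dl := (\matrix_(i, j) _) in BE.
have DlE (u : 'cV[int]_d) i : (Dl *m u) i 0 = l`_i * u i 0.
  rewrite mxE (bigD1 i)//= big1 ?addr0 => [|j ji]; first by rewrite mxE eqxx mulr1n.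
  by rewrite mxE eq_sym (negPf (ji : (j : nat) != i)) mulr0n mul0r.
have detDl : \det Dl = \prod_(i < d) l`_i.
  rewrite det_trig; first by apply: eq_bigr => i _; rewrite mxE eqxx.
  by apply/is_trig_mxP => i j ij; rewrite mxE ltn_eqF.
have unit1 (A : 'M[int]_d) : A \in unitmx -> `|\det A|%N = 1%N.
  by rewrite unitmxE => /orP[] /eqP ->.
have cardB : `|\det B|%N = (\prod_(i < d) `|(l`_i)%R|)%N.
  rewrite BE !det_mulmx !abszM (unit1 _ Lu) (unit1 _ Qu) mul1n muln1 detDl.
  by elim/big_ind2: _ => // x1 x2 y1 y2 <- <-; rewrite abszM.
have l0 (i : 'I_d) : l`_i != 0.
  apply: contraNneq detB => li; rewrite -absz_eq0 cardB (bigD1 i)//= li.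
  by rewrite absz0 mul0n.
pose X := {dffun forall i : 'I_d, 'I_(`|(l`_i)%R|)}.
exists X, (fun x : X => L *m \col_i (x i : nat)%:Z); split.
- rewrite card_dep_ffun cardB -prod_foldr.
  by congr foldr; apply: eq_map => i; rewrite card_ord.
- move=> n; pose w i := (invmx L *m n) i 0.
  pose rem (i : 'I_d) := (w i %% l`_i)%Z.
  have wlt (i : 'I_d) : (`|rem i| < `|(l`_i)%R|)%N.
    by rewrite -ltz_nat gez0_abs ?modz_ge0// ltz_mod.
  exists [ffun i => Ordinal (wlt i)].
  exists (invmx Q *m \col_i (w i %/ l`_i)%Z).
  rewrite BE -!mulmxA mulKVmx// -mulmxDr -[LHS](mulKVmx Lu); congr (_ *m _).
  apply/matrixP => i j; rewrite ord1 -/(w i) [RHS]mxE DlE.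
  rewrite [X in X + _]mxE [X in _ * X]mxE ffunE /= gez0_abs ?modz_ge0//.
  by rewrite addrC mulrC -divz_eq.
- move=> x y q; rewrite BE -!mulmxA -mulmxDr => /(congr1 (mulmx (invmx L))).
  rewrite !mulKmx// => /matrixP xy; apply/ffunP => i; apply: val_inj => /=.
  have := xy i 0; rewrite [RHS]mxE DlE !mxE.
  move=> /(congr1 (fun z => (z %% l`_i)%Z)).
  rewrite addrC [l`_i * _]mulrC modzMDl -!(modz_abs _ l`_i).
  by rewrite !modz_small ?le0z_nat ?ltz_nat ?ltn_ord// => -[].
Qed.

Section Fourier.
Local Open Scope complex_scope.
Variable R : realType.
Implicit Types th : R.

Lemma expNi2piD th th' :
  expNi2pi (th + th') = expNi2pi th * expNi2pi th'.
Proof.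
rewrite /expNi2pi mulrDr cosD sinD; apply/eqP; rewrite eq_complex /=.
by apply/andP; split; apply/eqP; ring.
Qed.

Lemma expNi2pi0 : expNi2pi 0 = 1 :> R[i].
Proof. by rewrite /expNi2pi mulr0 cos0 sin0 oppr0. Qed.

Lemma expNi2piNK th : expNi2pi (- th) * expNi2pi th = 1.
Proof. by rewrite -expNi2piD addNr expNi2pi0. Qed.

Lemma expNi2pi_int (n : int) : expNi2pi (n%:~R : R) = 1.
Proof.
have H (k : nat) : expNi2pi (k%:R : R) = 1.
  elim: k => [|k IHk]; first exact: expNi2pi0.
  rewrite -addn1 natrD expNi2piD IHk mul1r /expNi2pi mulr1 mulr_natl.
  by rewrite cos2pi sin2pi oppr0.
case: n => n; first exact: H.
by rewrite NegzE rmorphN -[LHS]mulr1 -[X in _ * X](H n.+1) expNi2piNK.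
Qed.

(** The fractional part r of th satisfies cos (2 pi r) = 1, hence
    sin (pi r) = 0; but the sine is positive on ]0, pi[. *)
Lemma expNi2pi_eq1 th : expNi2pi th = 1 -> th \is a Num.int.
Proof.
have fth := floor_itv th.
have thE : th = (Num.floor th)%:~R + (th - (Num.floor th)%:~R).
  by rewrite addrC subrK.
rewrite {1}thE expNi2piD expNi2pi_int mul1r.
set r := th - _ in thE *.
have [r0|r0] := eqVneq r 0; first by rewrite thE r0 addr0 => _; exact: intr_int.
have r_gt0 : 0 < r by rewrite lt_neqAle eq_sym r0 subr_ge0; case/andP: fth.
have r_lt1 : r < 1 by case/andP: fth => _; rewrite intrD => H; rewrite ltrBlDl.
move=> /eqP; rewrite eq_complex /= => /andP[/eqP c1 _].
have : 0 < sin (pi * r).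
  by apply: sin_gt0_pi; rewrite mulr_gt0 ?pi_gt0//= gtr_pMr// pi_gt0.
rewrite -mulrA mulr_natl cos_mulr2n cos2sin2 in c1.
have s0 : sin (pi * r) ^+ 2 = 0.
  by move: c1; set s := _ ^+ 2; rewrite -[_ *+ 2]mulr_natl; lra.
by move: s0 => /eqP; rewrite sqrf_eq0 => /eqP ->; rewrite ltxx.
Qed.

End Fourier.

Lemma inner_mulmx (R : realType) (d : nat) (A : 'M[R]_d) (x y : 'cV[R]_d) :
  inner x (A *m y) = inner (A^T *m x) y.
Proof.
have innerE (u v : 'cV[R]_d) : inner u v = (u^T *m v) 0 0.
  by rewrite mxE; apply: eq_bigr => j _; rewrite mxE.
by rewrite !innerE trmx_mul trmxK mulmxA.
Qed.

Lemma innerDl (R : realType) (d : nat) (x y z : 'cV[R]_d) :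
  inner (x + y) z = inner x z + inner y z.
Proof. by rewrite -big_split; apply: eq_bigr => j _; rewrite mxE mulrDl. Qed.

Lemma innerDr (R : realType) (d : nat) (x y z : 'cV[R]_d) :
  inner x (y + z) = inner x y + inner x z.
Proof. by rewrite -big_split; apply: eq_bigr => j _; rewrite mxE mulrDr. Qed.

Section Characters.
Local Open Scope complex_scope.
Variables (R : realType) (d : nat) (M : 'M[int]_d).
Hypothesis detM : \det M != 0.
Implicit Types (alpha beta gamma s q : 'cV[int]_d).

Lemma map_intr_unit (B : 'M[int]_d) : \det B != 0 ->
  (map_mx intr B : 'M[R]_d) \in unitmx.
Proof. by move=> detB; rewrite unitmxE unitfE det_map_mx intr_eq0. Qed.

(** The pairing of Z^d / M Z^d (first argument) with its dual group, identified
    with Z^d / M^T Z^d (second argument). *)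
Definition chi alpha s : R[i] :=
  expNi2pi (inner (int_cV R alpha) (invmx (map_mx intr M^T) *m int_cV R s)).

Lemma expNi2pi_inner_int alpha s :
  expNi2pi (inner (int_cV R alpha) (int_cV R s)) = 1.
Proof.
rewrite -[RHS](expNi2pi_int R (\sum_j alpha j 0 * s j 0)) rmorph_sum.
by congr expNi2pi; apply: eq_bigr => j _; rewrite !mxE rmorphM.
Qed.

Lemma chiDl alpha beta s : chi (alpha + beta) s = chi alpha s * chi beta s.
Proof. by rewrite /chi /int_cV map_mxD innerDl expNi2piD. Qed.

Lemma chiDr alpha s q : chi alpha (s + q) = chi alpha s * chi alpha q.
Proof. by rewrite /chi /int_cV map_mxD mulmxDr innerDr expNi2piD. Qed.

Lemma chi0 s : chi 0 s = 1.
Proof.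
rewrite /chi -[RHS](expNi2pi0 R); congr expNi2pi.
by rewrite /inner big1// => j _; rewrite !mxE mul0r.
Qed.

Lemma chi_lattice_r alpha q : chi alpha (M^T *m q) = 1.
Proof.
rewrite /chi /int_cV map_mxM mulKmx ?expNi2pi_inner_int//.
by rewrite map_intr_unit// det_tr.
Qed.

Lemma chi_invmx alpha s : chi alpha s =
  expNi2pi (inner (invmx (map_mx intr M) *m int_cV R alpha) (int_cV R s)).
Proof. by rewrite /chi inner_mulmx trmx_inv -map_trmx trmxK. Qed.

Lemma chi_lattice_l beta s : chi (M *m beta) s = 1.
Proof.
by rewrite chi_invmx /int_cV map_mxM mulKmx ?expNi2pi_inner_int ?map_intr_unit.
Qed.

(** The characters of the unit vectors test the coordinates of M^-1 alpha for
    integrality. *)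
Lemma chi_delta_eq1 alpha :
  (forall j, chi alpha (delta_mx j 0) = 1) -> exists beta, alpha = M *m beta.
Proof.
move=> chi1; set x := invmx (map_mx intr M) *m int_cV R alpha : 'cV[R]_d.
have xint j : x j 0 \is a Num.int.
  have := chi1 j; rewrite chi_invmx -/x => /expNi2pi_eq1.
  rewrite /inner (bigD1 j)//= big1 ?addr0 => [|i /negPf ij].
    by rewrite !mxE !eqxx mulr1.
  by rewrite !mxE ij mulr0.
exists (\col_j Num.floor (x j 0)).
have xE : x = map_mx intr (\col_j Num.floor (x j 0)).
  apply/matrixP => j k; rewrite ord1 [RHS]mxE [X in X%:~R]mxE.
  by have := xint j; rewrite intrEfloor => /eqP.
have : int_cV R alpha = map_mx intr (M *m \col_j Num.floor (x j 0)).
  by rewrite map_mxM -xE mulKVmx ?map_intr_unit.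
move=> /matrixP eqx; apply/matrixP => j k.
by have := eqx j k; rewrite [LHS]mxE [RHS]mxE => /intr_inj.
Qed.

Variables (X : finType) (sigma : X -> 'cV[int]_d).
Hypothesis sigma_surj : forall n, exists x q, n = sigma x + M^T *m q.
Hypothesis sigma_inj : forall x y q, sigma x = sigma y + M^T *m q -> x = y.

(** Orthogonality of the characters: if alpha - gamma is not in M Z^d, some e_j
    is paired with it to a value other than 1, and translation by e_j permutes
    the cosets of M^T Z^d, so it multiplies the sum by that value without
    changing it. *)
Lemma sum_chi alpha gamma :
  \sum_x chi (alpha - gamma) (sigma x) = #|X|%:R * (coset M gamma alpha)%:R.
Proof.
have [/asboolP[b ->]|/asboolPn ncos] := boolP (coset M gamma alpha).
  under eq_bigr => x _.
    rewrite addrAC subrr sub0r -mulmxN chi_lattice_l; over.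
  by rewrite sumr_const mulr1.
have [j chi_j] : exists j, chi (alpha - gamma) (delta_mx j 0) != 1.
  apply: contrapT => /forallNP chi1; apply: ncos.
  have [j|b abE] := @chi_delta_eq1 (alpha - gamma).
    by apply/eqP/negPn/negP; exact: chi1.
  by exists (- b); rewrite mulmxN opprK -abE addrC subrK.
rewrite mulr0; set S := \sum_x _.
have /choice[p pE] : forall x, exists y, exists q,
    sigma x + delta_mx j 0 = sigma y + M^T *m q.
  by move=> x; apply: sigma_surj.
have p_inj : injective p.
  move=> x y pxy; have [u xu] := pE x; have [v yv] := pE y.
  apply: (@sigma_inj _ _ (u - v)).
  apply: (addIr (delta_mx j 0)); rewrite xu pxy addrAC yv mulmxBr -addrA.
  by rewrite [_ *m v + _]addrC subrK.
have SE : chi (alpha - gamma) (delta_mx j 0) * S = S.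
  rewrite mulr_sumr /S [RHS](reindex_inj p_inj); apply: eq_bigr => x _.
  have [q xq] := pE x.
  by rewrite mulrC -chiDr xq chiDr chi_lattice_r mulr1.
apply/eqP; move/eqP: SE; rewrite -subr_eq0 -{2}[S]mul1r -mulrBl mulf_eq0.
by rewrite subr_eq0 (negPf chi_j).
Qed.

Lemma trig_evalE (a : 'cV[int]_d -> R) (l : seq 'cV[int]_d) s :
  uniq l -> (forall x, x \notin l -> a x = 0) ->
  trig_eval a (invmx (map_mx intr M^T) *m int_cV R s) =
  \sum_(alpha <- l) (a alpha)%:C * chi alpha s.
Proof. by move=> ul la; apply: fsum_seq => // x /la ->; rewrite mul0r. Qed.

(** Fourier inversion on Z^d / M Z^d: only the trivial character contributes to
    the sum of chi(-gamma, s) t(M^-T s) over the dual group, and exchanging the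
    sums turns the same expression into a coset sum by orthogonality. *)
Lemma coset_sum_Z0 (D : set 'cV[int]_d) (a : 'cV[int]_d -> R) gamma :
  digit_set M^T D -> Z0 M D a ->
  (#|X|%:R * \sum_(beta \in [set: 'cV[int]_d]) a (gamma - M *m beta))%:C =
  trig_eval a 0.
Proof.
move=> [D0 digits] [fa aD]; move: (fa) => /finsuppP[l ul la].
have evalE s := trig_evalE s ul la.
(* x0 represents the trivial coset, where t takes the value t(0) *)
have [x0 [q0 x0E]] := sigma_surj 0.
have eval_x0 : trig_eval a (invmx (map_mx intr M^T) *m int_cV R (sigma x0)) =
    trig_eval a 0.
  have -> : trig_eval a 0 =
      trig_eval a (invmx (map_mx intr M^T) *m int_cV R 0).
    by congr trig_eval; rewrite /int_cV map_mx0 mulmx0.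
  by rewrite !evalE; apply: eq_bigr => x _; rewrite x0E chiDr chi_lattice_r mulr1.
have chi_x0 al : chi al (sigma x0) = 1.
  have := chi_lattice_r al 0; rewrite mulmx0 x0E chiDr chi_lattice_r.
  by rewrite mulr1.
have eval_x x : x != x0 ->
    trig_eval a (invmx (map_mx intr M^T) *m int_cV R (sigma x)) = 0.
  move=> xx0; have [s [[Ds [q sE]] _]] := digits (sigma x).
  rewrite -(aD s Ds).
    by rewrite !evalE; apply: eq_bigr => y _; rewrite sE chiDr chi_lattice_r mulr1.
  move=> s0; move/eqP: xx0; apply; apply: (@sigma_inj _ _ (q0 + q)).
  by rewrite mulmxDr addrA -x0E sE s0.
have <- : \sum_x chi (- gamma) (sigma x) *
    trig_eval a (invmx (map_mx intr M^T) *m int_cV R (sigma x)) = trig_eval a 0.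
  rewrite (bigD1 x0)//= big1 ?addr0; first by rewrite eval_x0 chi_x0 mul1r.
  by move=> x /eval_x ->; rewrite mulr0.
under [RHS]eq_bigr do rewrite evalE mulr_sumr.
rewrite exchange_big /= (coset_sum detM gamma ul la) rmorphM rmorph_nat rmorph_sum.
rewrite mulr_sumr [LHS]big_mkcond /=; apply: eq_bigr => x _.
under eq_bigr do rewrite mulrCA -chiDl addrC.
rewrite -mulr_sumr sum_chi.
by case: ifP => _; rewrite ?mulr1 ?mulr0// mulrC.
Qed.

End Characters.

Lemma Z0_coset_sum (R : realType) (d : nat) (M : 'M[int]_d)
    (D : set 'cV[int]_d) (a : 'cV[int]_d -> R) (gamma : 'cV[int]_d) :
  \det M != 0 -> digit_set M^T D -> Z0 M D a ->
  \sum_(beta \in [set: 'cV[int]_d]) a (gamma - M *m beta) =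
  complex.Re (trig_eval a 0) / (`|\det M|%N)%:R.
Proof.
move=> detM hD ha.
have detMT : \det M^T != 0 by rewrite det_tr.
have [X [sigma [cardX surj inj]]] := coset_transversal detMT.
rewrite -(coset_sum_Z0 detM surj inj gamma hD ha) /= cardX det_tr mulrC mulKf//.
by rewrite pnatr_eq0 absz_eq0.
Qed.

(** * Sup-norms and geometric decay *)

Lemma linf_norm_leP (R : realType) (d : nat) (V : normedZmodType R)
    (f : 'cV[int]_d -> V) (B : R) :
  (linf_norm f <= B%:E)%E <-> forall alpha, `|f alpha| <= B.
Proof.
split=> [fB alpha|fB].
  rewrite -lee_fin; apply: le_trans fB.
  by apply: ereal_sup_ubound; exists alpha.
by apply: ge_ereal_sup => _ [alpha _ <-]; rewrite lee_fin.
Qed.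

Lemma linfP (R : realType) (d : nat) (V : normedZmodType R)
    (f : 'cV[int]_d -> V) :
  linf R d V f <-> exists B : R, forall alpha, `|f alpha| <= B.
Proof.
split=> [|[B /linf_norm_leP fB]]; last exact: (le_lt_trans fB (ltry B)).
rewrite /linf /= => foo.
have f0 : ((`|f 0|)%:E <= linf_norm f)%E by apply: ereal_sup_ubound; exists 0.
case fB : (linf_norm f) f0 foo => [B| |]//= _ _.
by exists B; apply/linf_norm_leP; rewrite fB.
Qed.

Lemma op_norm_le (R : realType) (d N : nat)
    (S : ('cV[int]_d -> 'cV[R]_N) -> 'cV[int]_d -> 'cV[R]_N) (e B : R)
    (u : 'cV[int]_d -> 'cV[R]_N) :
  (forall (c : R) v, S (fun alpha => c *: v alpha) = fun alpha => c *: S v alpha) ->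
  (op_norm S <= e%:E)%E -> 0 < B -> (forall alpha, `|u alpha| <= B) ->
  forall alpha, `|S u alpha| <= e * B.
Proof.
move=> SZ Se B0 uB alpha.
have : (linf_norm (S (fun x => B^-1 *: u x)) <= e%:E)%E.
  apply: le_trans Se; apply: ereal_sup_ubound.
  exists (fun x => B^-1 *: u x) => //=; apply/linf_norm_leP => x.
  by rewrite mx_normZ gtr0_norm ?invr_gt0// ler_pdivrMl// mulr1.
move=> /linf_norm_leP /(_ alpha).
by rewrite SZ mx_normZ gtr0_norm ?invr_gt0// ler_pdivrMl// mulrC.
Qed.

(** Let dl_k bound u_k and satisfy dl_(k + k0) = dl_k / 2.  The sums P_k of
    2 dl_j over k <= j < k + k0 have the differences
    P_k - P_(k+1) = 2 (dl_k - dl_(k + k0)) = dl_k, and they tend to 0 because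
    they decrease and P_(k + k0) = P_k / 2. *)
Lemma geometric_tail (R : realType) (I : Type) (V : normedZmodType R)
    (u : nat -> I -> V) (k0 : nat) :
  (0 < k0)%N ->
  (forall k, exists B : R, forall i, `|u k i| <= B) ->
  (forall k (B : R), 0 < B -> (forall i, `|u k i| <= B) ->
     forall i, `|u (k + k0)%N i| <= B / 2) ->
  exists P : nat -> R, [/\ forall k, 0 <= P k, P @ \oo --> (0 : R)
    & forall k i, `|u k i| <= P k - P k.+1].
Proof.
move=> k0_gt0 ubd uhalf.
have /choice[b bP] : forall k, exists B : R, 0 < B /\ forall i, `|u k i| <= B.
  move=> k; have [B uB] := ubd k; exists (Num.max B 1).
  by split=> [|i]; rewrite ?lt_max ?ltr01 ?orbT// le_max uB.
pose dl k := b (k %% k0)%N / 2 ^+ (k %/ k0).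
have dl_gt0 k : 0 < dl k by rewrite divr_gt0 ?exprn_gt0//; case: (bP (k %% k0)%N).
have dl_half k : dl (k + k0)%N = dl k / 2.
  by rewrite /dl modnDr divnDr ?dvdnn// divnn k0_gt0 addn1 exprSr invfM mulrA.
have u_dl k i : `|u k i| <= dl k.
  rewrite (divn_eq k k0); elim: (k %/ k0)%N i => [|q IHq] i.
    rewrite mul0n add0n /dl modn_mod divn_small ?ltn_pmod// expr0 divr1.
    by case: (bP (k %% k0)%N).
  rewrite mulSnr addnAC dl_half; apply: uhalf => //; exact: IHq.
pose P k := 2 * \sum_(k <= j < k + k0) dl j.
have P_ge0 k : 0 <= P k by rewrite mulr_ge0// sumr_ge0// => j _; exact: ltW.
have PS k : dl k = P k - P k.+1.
  have ltk : (k < k + k0)%N by rewrite -[ltnLHS]addn0 ltn_add2l.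
  by rewrite /P big_ltn// addSn big_nat_recr//= -mulrBr addrKA dl_half; lra.
have P_half k : P (k + k0)%N = P k / 2.
  rewrite /P -mulrA; congr (_ * _); rewrite mulr_suml big_addn addnK.
  by apply: eq_bigr => j _; rewrite dl_half.
have P_mono : {homo P : n m / (n <= m)%N >-> m <= n}.
  apply: homo_leq => // [x y z xy yz|k]; first exact: le_trans yz xy.
  by rewrite -subr_ge0 -PS ltW.
exists P; split=> //; last by move=> k i; rewrite -PS.
have [l cP] : exists l : R, P @ \oo --> l.
  exists (limn P); apply: nonincreasing_is_cvgn => //.
  by exists 0 => _ [k _ <-].
have : [sequence P (n + k0)%N]_n @ \oo --> l by rewrite cvg_shiftn.
have -> : [sequence P (n + k0)%N]_n = (fun n => P n * 2^-1).
  by apply/funext => n; rewrite /= P_half.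
have : (fun n => P n * 2^-1) @ \oo --> l * 2^-1 by apply: cvgMl.
move=> h1 h2.
have limE : l * 2^-1 = l by apply: cvg_unique h1 h2; exact: norm_hausdorff.
by suff <- : l = 0 by []; lra.
Qed.

(** * Gradients control differences *)

Section Gradient.
Variables (R : realType) (d : nat).
Implicit Types (f : 'cV[int]_d -> R) (x : 'cV[R]_d).

Lemma le_mx_norm x j : `|x j 0| <= `|x|.
Proof.
rewrite -[leRHS]/(mx_norm x) mx_normrE.
by rewrite (le_bigmax _ (fun ij => `|x ij.1 ij.2|) (j, 0)).
Qed.

Lemma mx_norm_le x (B : R) : 0 <= B -> (forall j, `|x j 0| <= B) -> `|x| <= B.
Proof.
move=> B0 xB; rewrite -[leLHS]/(mx_norm x) mx_normrE.
by apply: bigmax_le => // -[j k] _; rewrite ord1.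
Qed.

Definition l1norm (v : 'cV[int]_d) : R := \sum_j `|(v j 0)%:~R|.

Lemma gradient_bounded f (B : R) : (forall alpha, `|f alpha| <= B) ->
  forall alpha, `|gradient f alpha| <= 2 * B.
Proof.
move=> fB alpha.
apply: mx_norm_le => [|j]; first by rewrite mulr_ge0// (le_trans _ (fB 0)).
by rewrite mxE (le_trans (ler_normB _ _))// mulr_natl mulr2n lerD.
Qed.

(** Walk from beta to beta + v along the coordinate directions, in l1norm v unit
    steps. *)
Lemma gradient_lipschitz f (e : R) : (forall alpha, `|gradient f alpha| <= e) ->
  forall v beta, `|f (beta + v) - f beta| <= l1norm v * e.
Proof.
move=> fe v.
have step j beta : `|f (beta + delta_mx j 0) - f beta| <= e.
  have := le_trans (le_mx_norm _ j) (fe (beta + delta_mx j 0)).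
  by rewrite mxE addrK.
have steps j (n : nat) beta :
    `|f (beta + n%:Z *: delta_mx j 0) - f beta| <= n%:R * e.
  elim: n => [|n IHn]; first by rewrite scale0r addr0 subrr normr0 mul0r.
  rewrite -(addn1 n) PoszD natrD mulrDl mul1r scalerDl scale1r addrA.
  apply: le_trans (ler_distD (f (beta + n%:Z *: delta_mx j 0)) _ _) _.
  by rewrite [leLHS]addrC lerD.
rewrite /l1norm {1}(matrix_sum_delta v) mulr_suml.
pose K (w : 'cV[int]_d) (c : R) := forall beta, `|f (beta + w) - f beta| <= c.
apply: (big_ind2 K) => [beta|w1 c1 w2 c2 h1 h2 beta|j _ beta].
- by rewrite addr0 subrr normr0.
- rewrite addrA; apply: le_trans (ler_distD (f (beta + w1)) _ _) _.
  by rewrite [leLHS]addrC lerD.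
rewrite big_ord1; case: (v j 0) => n; first by rewrite normr_nat.
rewrite NegzE scaleNr rmorphN normrN normr_nat distrC.
by have := steps j n.+1 (beta - n.+1%:Z *: delta_mx j 0); rewrite subrK.
Qed.

End Gradient.

(** * The limit of the step functions *)

(** A crude bound for the operator norm of A on the max-norm. *)
Definition entry_sum (R : realType) (m n : nat) (A : 'M[R]_(m, n)) : R :=
  \sum_i \sum_j `|A i j|.

Definition floor_cV (R : realType) (d : nat) (x : 'cV[R]_d) : 'cV[int]_d :=
  \col_j Num.floor (x j 0).

Section Estimates.
Variables (R : realType) (d : nat).
Implicit Types (x y : 'cV[R]_d) (v : 'cV[int]_d).

Lemma entry_sum_ge0 (A : 'M[R]_d) : 0 <= entry_sum A.
Proof. by apply: sumr_ge0 => i _; apply: sumr_ge0. Qed.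

Lemma mulmx_norm_le (A : 'M[R]_d) x : `|A *m x| <= entry_sum A * `|x|.
Proof.
apply: mx_norm_le => [|i]; first by rewrite mulr_ge0// entry_sum_ge0.
have le_row : \sum_j `|A i j| <= entry_sum A.
  rewrite /entry_sum [leRHS](bigD1 i)//= lerDl sumr_ge0// => k _.
  exact: sumr_ge0.
apply: le_trans (ler_wpM2r (normr_ge0 x) le_row).
rewrite mxE mulr_suml; apply: le_trans (ler_norm_sum _ _ _) _.
by apply: ler_sum => j _; rewrite normrM ler_wpM2l// le_mx_norm.
Qed.

Lemma l1norm_le v : l1norm R v <= d%:R * `|int_cV R v|.
Proof.
rewrite mulr_natl -[X in _ *+ X]card_ord -sumr_const; apply: ler_sum => j _.
by have := le_mx_norm (int_cV R v) j; rewrite mxE.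
Qed.

Lemma floor_cV_le x : `|int_cV R (floor_cV x) - x| <= 1.
Proof.
apply: mx_norm_le => // j; rewrite !mxE distrC.
have /andP[h1 h2] := floor_itv (x j 0); rewrite intrD in h2.
by rewrite ger0_norm; lra.
Qed.

(** M y - M floor(y) = M r for the fractional part r of y, whose coordinates are
    at most 1, and rounding M y changes each coordinate by at most 1. *)
Lemma floor_cV_mulmx (M : 'M[int]_d) y :
  `|int_cV R (floor_cV (map_mx intr M *m y) - M *m floor_cV y)|
  <= 1 + entry_sum (map_mx intr M : 'M[R]_d).
Proof.
set z := _ *m y; set n := floor_cV y.
have -> : int_cV R (floor_cV z - M *m n) =
    (int_cV R (floor_cV z) - z) - map_mx intr M *m (int_cV R n - y).
  by rewrite /int_cV map_mxB map_mxM mulmxBr opprB addrA subrK.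
apply: le_trans (ler_normB _ _) _; apply: lerD; first exact: floor_cV_le.
apply: le_trans (mulmx_norm_le _ _) _.
by rewrite ler_piMr ?entry_sum_ge0// floor_cV_le.
Qed.

(** Two reals at distance less than 1 have floors that differ by at most 1. *)
Lemma floor_cV_near x y : `|x - y| < 1 ->
  l1norm R (floor_cV x - floor_cV y) <= d%:R.
Proof.
move=> xy; apply: le_trans (l1norm_le _) _; rewrite ler_piMr//.
apply: mx_norm_le => // j; rewrite !mxE.
have := le_lt_trans (le_mx_norm _ j) xy; rewrite !mxE ltr_norml => /andP[h1 h2].
have /andP[] := floor_itv (x j 0); have /andP[] := floor_itv (y j 0).
rewrite !intrD => h3 h4 h5 h6.
set p := Num.floor (x j 0) in h5 h6 *; set q := Num.floor (y j 0) in h3 h4 *.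
have pq : p < q + 2 by rewrite -(@ltr_int R) intrD; lra.
have qp : q < p + 2 by rewrite -(@ltr_int R) intrD; lra.
by rewrite -intrD -intr_norm -[leRHS]/(1%:~R) ler_int; lia.
Qed.

End Estimates.

(** Every lower bound h_j - C P_j lies below every upper bound h_k + C P_k; the
    limit is the supremum of the lower bounds. *)
Lemma telescoping_limit (R : realType) (T : Type) (h : nat -> T -> R)
    (P : nat -> R) (C : R) :
  0 <= C -> (forall k, 0 <= P k) ->
  (forall k x, `|h k.+1 x - h k x| <= C * (P k - P k.+1)) ->
  exists g : T -> R, forall k x, `|h k x - g x| <= C * P k.
Proof.
move=> C0 P0 hP.
have hD k n x : `|h (k + n)%N x - h k x| <= C * (P k - P (k + n)%N).
  elim: n => [|n IHn]; first by rewrite addn0 !subrr normr0 mulr0.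
  rewrite addnS; apply: le_trans (ler_distD (h (k + n)%N x) _ _) _.
  by have := hP (k + n)%N x; lra.
have le_low_up j k x : h j x - C * P j <= h k x + C * P k.
  have CP i : 0 <= C * P i by rewrite mulr_ge0.
  have [jk|/ltnW kj] := leqP j k.
    have := hD j (k - j)%N x; rewrite subnKC// ler_norml => /andP[h1 h2].
    by have := CP j; have := CP k; lra.
  have := hD k (j - k)%N x; rewrite subnKC// ler_norml => /andP[h1 h2].
  by have := CP j; have := CP k; lra.
exists (fun x => sup (range (fun j => h j x - C * P j))) => k x.
pose E := range (fun j => h j x - C * P j); rewrite -[X in _ - X]/(sup E).
have E0 : E !=set0 by exists (h 0%N x - C * P 0%N); exists 0%N.
have hi : sup E <= h k x + C * P k.
  by apply: ge_sup => // _ [j _ <-]; exact: le_low_up.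
have lo : h k x - C * P k <= sup E.
  apply: ub_le_sup; last by exists k.
  by exists (h k x + C * P k) => _ [j _ <-]; exact: le_low_up.
by rewrite ler_norml; lra.
Qed.

Section Convergence.
Variables (R : realType) (d : nat) (M : 'M[int]_d) (a : 'cV[int]_d -> R).
Hypothesis detM : \det M != 0.
Hypothesis fa : finitely_supported a.
Local Notation S := (scalar_subdivision M a).
Local Notation Mr := (map_mx intr M : 'M[R]_d).

Lemma ler_sum_coset (F : 'cV[int]_d -> R) (s r : seq 'cV[int]_d) alpha :
  uniq s -> uniq r -> (forall beta, (beta \in r) = (alpha - M *m beta \in s)) ->
  (forall x, 0 <= F x) -> (forall x, x \notin s -> F x = 0) ->
  \sum_(beta <- r) F (alpha - M *m beta) <= \sum_(x <- s) F x.
Proof.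
move=> us ur rE F0 sF; rewrite -(@fsum_seq _ _ (fun b => F (alpha - M *m b)))//.
  rewrite (coset_sum detM alpha us sF) big_mkcond; apply: ler_sum => x _.
  by case: ifP.
by move=> b; rewrite rE => /sF.
Qed.

Lemma subdiv_bounded f (B : R) : (forall alpha, `|f alpha| <= B) ->
  exists B' : R, forall alpha, `|S f alpha| <= B'.
Proof.
move=> fB; have /finsuppP[s us sa] := fa.
exists ((\sum_(x <- s) `|a x|) * B) => alpha.
have [r ur rE] := coset_seq detM s alpha.
rewrite (@subdivE _ _ _ _ s r)// => [|b]; last by rewrite rE.
apply: le_trans (ler_norm_sum _ _ _) _.
apply: le_trans (_ : (\sum_(b <- r) `|a (alpha - M *m b)|) * B <= _).
  by rewrite mulr_suml; apply: ler_sum => b _; rewrite normrM ler_wpM2l.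
apply: ler_wpM2r; first exact: le_trans (fB 0).
apply: (@ler_sum_coset (fun x => `|a x|)) => // x /sa ->.
exact: normr0.
Qed.

Lemma iter_subdiv_linf f k : linf R d R f -> linf R d R (iter k S f).
Proof.
move=> lf; elim: k => // k /linfP[B fB].
by have [B' ?] := subdiv_bounded fB; apply/linfP; exists B'.
Qed.

Hypothesis sum_rule : forall gamma,
  \sum_(beta \in [set: 'cV[int]_d]) a (gamma - M *m beta) = 1.

(** Since the mask has sum 1 on each coset,
    (S h)_alpha - h_beta0 = sum_beta a(alpha - M beta) (h_beta - h_beta0).  With
    gamma = alpha - M beta in the support of the mask,
    beta - beta0 = M^-1 ((alpha - M beta0) - gamma) is bounded by the distance K
    and the size of gamma. *)
Lemma subdiv_local (K : R) : 0 <= K -> exists2 C : R, 0 <= C &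
  forall h (e : R), (forall alpha, `|gradient h alpha| <= e) ->
  forall alpha beta0, `|int_cV R (alpha - M *m beta0)| <= K ->
  `|S h alpha - h beta0| <= C * e.
Proof.
move=> K0; have /finsuppP[s us sa] := fa.
pose F x := `|a x| * (d%:R * (entry_sum (invmx Mr) * (K + `|int_cV R x|))).
have F0 x : 0 <= F x by rewrite !mulr_ge0 ?entry_sum_ge0 ?addr_ge0.
exists (\sum_(x <- s) F x) => [|h e he alpha beta0 abK]; first exact: sumr_ge0.
have e0 : 0 <= e by exact: le_trans (he 0).
have [r ur rE] := coset_seq detM s alpha.
have -> : S h alpha - h beta0 =
    \sum_(b <- r) a (alpha - M *m b) * (h b - h beta0).
  rewrite (@subdivE _ _ _ _ s r)// => [|b]; last by rewrite rE.
  have h0E : (\sum_(b <- r) a (alpha - M *m b)) * h beta0 = h beta0.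
    rewrite -(@fsum_seq _ _ (fun b => a (alpha - M *m b)))//.
      by rewrite sum_rule mul1r.
    by move=> b; rewrite rE => /sa.
  rewrite -{1}h0E mulr_suml -sumrB.
  by apply: eq_bigr => b _; rewrite mulrBr.
apply: le_trans (ler_norm_sum _ _ _) _.
apply: le_trans (_ : (\sum_(b <- r) F (alpha - M *m b)) * e <= _); last first.
  apply: ler_wpM2r => //; apply: ler_sum_coset => // x /sa ax.
  by rewrite /F ax normr0 mul0r.
rewrite mulr_suml; apply: ler_sum => b _; rewrite normrM /F -mulrA ler_wpM2l//.
have := gradient_lipschitz he (b - beta0) beta0; rewrite subrKC => hb.
apply: le_trans hb _; apply: ler_wpM2r => //.
apply: le_trans (l1norm_le _ _) _; apply: ler_wpM2l => //.
set g := alpha - M *m b.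
have -> : int_cV R (b - beta0) =
    invmx Mr *m (int_cV R (alpha - M *m beta0) - int_cV R g).
  rewrite -[LHS](mulKmx (map_intr_unit R detM)); congr (_ *m _).
  rewrite /int_cV -map_mxM -map_mxB; congr map_mx.
  by rewrite mulmxBr opprB [RHS]addrC subrKA.
apply: le_trans (mulmx_norm_le _ _) _; apply: ler_wpM2l; first exact: entry_sum_ge0.
by apply: le_trans (ler_normB _ _) _; rewrite lerD2r.
Qed.

(** The step functions h_k(x) = u_k (floor (M^k x)) interpolate the iterates
    u_k = S^k f at the points M^-k alpha; they converge uniformly, and their
    jumps near any point tend to 0. *)
Lemma exists_subdivision_limit f (P : nat -> R) :
  (forall k, 0 <= P k) -> P @ \oo --> (0 : R) ->
  (forall k alpha, `|gradient (iter k S f) alpha| <= P k - P k.+1) ->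
  exists g, subdivision_limit M a f g.
Proof.
move=> P0 cP gradP.
have K0 : 0 <= 1 + entry_sum Mr by rewrite addr_ge0// entry_sum_ge0.
have [C C0 SC] := subdiv_local K0.
pose h k (x : 'cV[R]_d) := iter k S f (floor_cV (Mr ^+ k *m x)).
have hP k x : `|h k.+1 x - h k x| <= C * (P k - P k.+1).
  rewrite /h /= exprS -mulmxE -mulmxA; apply: SC => //.
  exact: floor_cV_mulmx.
have [g gP] := telescoping_limit C0 P0 hP.
have unitMk k : Mr ^+ k \in unitmx.
  elim: k => [|k IHk]; first by rewrite expr0 unitmx1.
  by rewrite exprS -mulmxE unitmx_mul map_intr_unit.
exists g; split.
  move=> x; apply/(@cvgrPdist_le _ _ _ _ (nbhs_filter x)) => e e0.
  (* |g x - g y| is at most C P_k + d P_k + C P_k; the last term keeps c > 0 *)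
  pose c := C + d%:R + C + 1.
  have c0 : 0 < c by rewrite ltr_wpDl// !addr_ge0.
  have /cvgrPdist_le /(_ _ (divr_gt0 e0 c0)) [k _ /(_ _ (leqnn k))] := cP.
  rewrite /= sub0r normrN ger0_norm// ler_pdivlMr// mulrC => Pk.
  have A0 := entry_sum_ge0 (Mr ^+ k).
  have A1 : 0 < (1 + entry_sum (Mr ^+ k))^-1 by rewrite invr_gt0 ltr_pwDl.
  near=> y.
  have xy : `|x - y| < (1 + entry_sum (Mr ^+ k))^-1.
    by near: y; apply: cvgr_dist_lt => //; exact: cvg_id.
  have hxy : `|h k x - h k y| <= d%:R * P k.
    have := gradient_lipschitz (gradP k) (floor_cV (Mr ^+ k *m x) -
      floor_cV (Mr ^+ k *m y)) (floor_cV (Mr ^+ k *m y)).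
    rewrite subrKC => hxy; apply: le_trans hxy _.
    have dP0 : 0 <= P k - P k.+1 by exact: le_trans (gradP k 0).
    have dPle : P k - P k.+1 <= P k by rewrite gerBl.
    apply: le_trans (ler_wpM2l (ler0n _ d) dPle); apply: ler_wpM2r => //.
    apply: floor_cV_near; rewrite -mulmxBr.
    apply: le_lt_trans (mulmx_norm_le _ _) _.
    have [xy0|xy0] := eqVneq `|x - y| 0; first by rewrite xy0 mulr0.
    rewrite -[X in _ < X](mulfV (lt0r_neq0 (ltr_pwDl ltr01 A0))).
    apply: ltr_pM => //; first by rewrite ltrDr.
  apply: le_trans (ler_distD (h k x) _ _) _.
  rewrite distrC; apply: le_trans (lerD (gP k x) (ler_distD (h k y) _ _)) _.
  have := gP k y; have := P0 k; rewrite /c in Pk; lra.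
apply: (@squeeze_cvge _ _ _ _ (fun=> 0%E) _ (fun k => (C * P k)%:E)).
- near=> k; apply/andP; split.
    pose e0 := `|iter k S f 0 - g (invmx (Mr ^+ k) *m int_cV R 0)|.
    apply: (@le_trans _ _ e0%:E); first by rewrite lee_fin normr_ge0.
    by apply: ereal_sup_ubound; exists 0.
  apply/linf_norm_leP => alpha.
  have := gP k (invmx (Mr ^+ k) *m int_cV R alpha).
  rewrite /h mulKVmx//.
  suff -> : floor_cV (int_cV R alpha) = alpha by [].
  by apply/matrixP => i j; rewrite !mxE intrKfloor ord1.
- exact: cvg_cst.
- apply: cvg_EFin; first by near=> k.
  by rewrite -[X in _ --> X](mulr0 C); apply: cvgMr.
Unshelve. all: by end_near.
Qed.

End Convergence.

(** * Uniform convergence from contractivity *)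

Lemma subdivisionZ (R : realType) (d N : nat) (M : 'M[int]_d)
    (A : 'cV[int]_d -> 'M[R]_N) (c : R) (f : 'cV[int]_d -> 'cV[R]_N) :
  \det M != 0 -> finitely_supported A ->
  subdivision M A (fun alpha => c *: f alpha) =
  fun alpha => c *: subdivision M A f alpha.
Proof.
move=> detM /finsuppP[s _ sA]; apply/funext => alpha.
have [r ur rE] := coset_seq detM s alpha.
rewrite /subdivision !(@fsum_seq _ _ _ r)// => [|b|b].
- by rewrite scaler_sumr; apply: eq_bigr => b _; rewrite scalemxAr.
- by rewrite rE => /sA ->; rewrite mul0mx.
- by rewrite rE => /sA ->; rewrite mul0mx.
Qed.

Lemma subdivision_limit_cst1 (R : realType) (d : nat) (M : 'M[int]_d)
    (a : 'cV[int]_d -> R) :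
  (forall gamma, \sum_(beta \in [set: 'cV[int]_d]) a (gamma - M *m beta) = 1) ->
  subdivision_limit M a (fun=> 1) (fun=> 1).
Proof.
move=> sum_rule; split; first exact: cst_continuous.
have S1 : scalar_subdivision M a (fun=> 1) = fun=> 1.
  apply/funext => alpha; rewrite -[RHS](sum_rule alpha).
  by apply: eq_fsbigr => b _; rewrite mulr1.
have iterS1 k : iter k (scalar_subdivision M a) (fun=> 1) = fun=> 1.
  by elim: k => //= k ->.
under eq_fun => k.
  rewrite iterS1; under eq_fun do rewrite subrr.
  over.
have -> : linf_norm (fun _ : 'cV[int]_d => 0 : R) = 0%E.
  apply/le_anti/andP; split; first by apply/linf_norm_leP => x; rewrite normr0.
  by apply: ereal_sup_ubound; exists 0 => //; rewrite normr0.
exact: cvg_cst.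
Qed.

(** Some power S_T^k0 has norm at most 1/2, so the gradients of the iterates
    S_a^k f, which are S_T^k (grad f), are halved every k0 steps. *)
Lemma contractive_uniformly_convergent (R : realType) (d : nat) (M : 'M[int]_d)
    (a : 'cV[int]_d -> R) (T : 'cV[int]_d -> 'M[R]_d) :
  \det M != 0 -> finitely_supported a -> finitely_supported T ->
  (forall gamma, \sum_(beta \in [set: 'cV[int]_d]) a (gamma - M *m beta) = 1) ->
  (forall f, linf R d R f ->
     gradient (scalar_subdivision M a f) = subdivision M T (gradient f)) ->
  op_norm (iter k (subdivision M T)) @[k --> \oo] --> 0%E ->
  uniformly_convergent M a.
Proof.
move=> detM fa fT sum_rule comm T0; split=> [f lf|]; last first.
  exists (fun=> 1), (fun=> 1); split; last by exists 0; exact: oner_neq0.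
  - by apply/linfP; exists 1 => _; rewrite normr1.
  - exact: subdivision_limit_cst1.
pose S := scalar_subdivision M a.
have grad_iter k n : gradient (iter (k + n) S f) =
    iter n (subdivision M T) (gradient (iter k S f)).
  elim: n => [|n IHn]; first by rewrite addn0.
  by rewrite addnS /= comm ?IHn//; exact: iter_subdiv_linf.
have [k0 k0_gt0 Tk0] : exists2 k0, (0 < k0)%N &
    (op_norm (iter k0 (subdivision M T)) <= (2^-1)%:E)%E.
  have half0 : (0 : R) < 2^-1 by rewrite invr_gt0.
  have [k _ kT] := T0 _ (@nbhs_open_ereal_lt R 0 (fun=> 2^-1) half0).
  exists k.+1 => //; apply: ltW; exact: kT (leqnSn k).
have iterZ n (c : R) v : iter n (subdivision M T) (fun alpha => c *: v alpha) =
    fun alpha => c *: iter n (subdivision M T) v alpha.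
  by elim: n => //= n ->; rewrite subdivisionZ.
have [|k|k B B0 gB alpha|P [P0 cP gradP]] :=
    @geometric_tail R _ _ (fun k => gradient (iter k S f)) k0.
- by [].
- have /linfP[B fB] := iter_subdiv_linf detM fa k lf.
  by exists (2 * B) => alpha; exact: gradient_bounded.
- by rewrite grad_iter mulrC; exact: (op_norm_le (iterZ k0) Tk0).
exact: exists_subdivision_limit gradP.
Qed.

Unset Implicit Arguments.

Theorem mainTheorem5 (R : realType) (d : nat) (hd : (0 < d)%N)
    (M : 'M[int]_d) (hM : dilation_matrix R M)
    (D : set 'cV[int]_d) (hD : digit_set M^T D)
    (t : 'cV[int]_d -> R) (ht : Z0 M D t) :
  (exists T : 'cV[int]_d -> 'M[R]_d,
      finitely_supported T /\
      forall f, linf R d R f ->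
        gradient (scalar_subdivision M t f) = subdivision M T (gradient f)) /\
  (trig_eval t 0 = (`|\det M|%N)%:R ->
   forall T : 'cV[int]_d -> 'M[R]_d,
     finitely_supported T ->
     (forall f, linf R d R f ->
        gradient (scalar_subdivision M t f) = subdivision M T (gradient f)) ->
     op_norm (iter k (subdivision M T)) @[k --> \oo] --> 0%E ->
     uniformly_convergent M t).
Proof.
have detM : \det M != 0 by case: hM.
have ft : finitely_supported t by case: ht.
have sum_rule gamma := Z0_coset_sum gamma detM hD ht.
split=> [|t0 T fT comm T0].
  by have [T [fT TE]] := exists_gradient_mask detM ft sum_rule; exists T.
apply: (contractive_uniformly_convergent detM ft fT) => // gamma.
by rewrite sum_rule t0 raddfMn /= divff// pnatr_eq0 absz_eq0.
Qed.
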